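(* Let $p\ge 2$, $N\ge 1$, and let $\mathcal{C}=\{\mathbf{c}_0,\dots,\mathbf{c}_{M-1}\}\subseteq\{0,\dots,p-1\}^N$ be a code with index set $\mathcal{I}=\{0,\dots,M-1\}$. For each $\ell\in\mathcal{I}$, suppose that when $\mathbf{c}_\ell$ is transmitted the output $\mathbf{r}=(r_1,\dots,r_N)\in\{0,\dots,p-1\}^N$ has independent coordinates, with symbol-error probabilities $\epsilon_{\ell,i}=\mathbb{P}(r_i\neq c_{\ell,i}\mid \mathbf{c}_\ell\text{ sent})\in(0,1)$, $i=1,\dots,N$. For an ordered pair $(\ell,\ell')$ with $\ell\neq\ell'$, let $D(\ell,\ell')=\{i: c_{\ell,i}\neq c_{\ell',i}\}$, $d=|D(\ell,\ell')|$, and $d_{\mathrm{wmin}}(\ell,\ell')=\sum_{i\in D(\ell,\ell')}\log(1/\epsilon_{\ell,i})$. Define the events (under transmission of $\mathbf{c}_\ell$) $$\mathcal{A}_{\mathrm{MD}}(\ell'\mid\ell)=\Big\{\#\{i\in D(\ell,\ell'): r_i\neq c_{\ell,i}\}>\Big\lfloor\tfrac{d-1}{2}\Big\rfloor\Big\},$$ $$\mathcal{A}_{\mathrm{wMD}}(\ell'\mid\ell)=\Big\{\textstyle\sum_{i\in D(\ell,\ell')}\log(1/\epsilon_{\ell,i})\,\mathbf{1}_{\{r_i\neq c_{\ell,i}\}}>\tfrac{1}{2}d_{\mathrm{wmin}}(\ell,\ell')\Big\}.$$ Call a pair $(\ell,\ell')$ trivial if there is a codeword $\mathbf{c}_{\ell''}$,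 $\ell''\neq \ell$, with $D(\ell,\ell'')$ a proper subset of $D(\ell,\ell')$; for trivial pairs both error probabilities are set to $0$. Define $$P_{\mathrm{e,MD}}=\frac{1}{|\mathcal{I}|}\sum_{\ell\in\mathcal{I}}\sum_{\ell'\neq\ell,\ (\ell,\ell')\text{ nontrivial}}\mathbb{P}(\mathcal{A}_{\mathrm{MD}}(\ell'\mid\ell)),\qquad P_{\mathrm{e,wMD}}=\frac{1}{|\mathcal{I}|}\sum_{\ell\in\mathcal{I}}\sum_{\ell'\neq\ell,\ (\ell,\ell')\text{ nontrivial}}\mathbb{P}(\mathcal{A}_{\mathrm{wMD}}(\ell'\mid\ell)).$$ Then $P_{\mathrm{e,wMD}}\le P_{\mathrm{e,MD}}$.
   Context: Context: uplink MIMO with $K$ single-antenna users, $m$-ary messages, and $p$-level ADCs at a base station with $N_{\rm r}$ antennas, $N=2N_{\rm r}$. The code $\mathcal{C}$ has $M=m^K$ codewords $\mathbf{c}_\ell=[\phi_p(\mathbf{h}_1^{\mathsf T}\mathbf{x}(g(\ell))),\dots,\phi_p(\mathbf{h}_N^{\mathsf T}\mathbf{x}(g(\ell)))]^{\mathsf T}$, where $\phi_p$ is the ADC quantizer, $\mathbf{h}_i^{\mathsf T}$ the rows of the real channel matrix and $\mathbf{x}(g(\ell))$ the transmitted real symbol vector for message index $\ell$; the received vector is $r_i=\phi_p(\mathbf{h}_i^{\mathsf T}\mathbf{x}+z_i)$ with independent Gaussian noise, giving independent coordinates. Minimum distance decoding (MDD) picks $\arg\min_\ell$ of the Hamming distance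 $d_{\rm h}(\mathbf{r},\mathbf{c}_\ell)$; weighted minimum distance decoding (wMDD) picks $\arg\min_\ell \sum_{i=1}^N \log(1/\epsilon_{\ell,i})\mathbf{1}_{\{r_i\neq c_{\ell,i}\}}$. The events $\mathcal{A}_{\mathrm{MD}}(\ell'|\ell)$, $\mathcal{A}_{\mathrm{wMD}}(\ell'|\ell)$ are the pairwise events that MDD, resp. wMDD, selects $\mathbf{c}_{\ell'}$ over the transmitted $\mathbf{c}_\ell$, as defined in the claim. *)

(* Defs.v *)
From mathcomp Require Import all_boot.
From Stdlib Require Import Reals.
Set Implicit Arguments.
Unset Strict Implicit.
Unset Printing Implicit Defensive.

Section Code.
Variables (p N M : nat).
Variable c : 'I_M -> 'I_N -> 'I_p.
(* channel: q l i a = P(r_i = a | c_l sent); coordinates independent *)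
Variable q : 'I_M -> 'I_N -> 'I_p -> R.
Variable eps : 'I_M -> 'I_N -> R.

Definition Dset (l l' : 'I_M) : {set 'I_N} := [set i | c l i != c l' i].

Definition prob_r (l : 'I_M) (r : {ffun 'I_N -> 'I_p}) : R :=
  \big[Rmult/1%R]_(i : 'I_N) q l i (r i).

Definition Prob (l : 'I_M) (A : {ffun 'I_N -> 'I_p} -> bool) : R :=
  \big[Rplus/0%R]_(r : {ffun 'I_N -> 'I_p}) (if A r then prob_r l r else 0%R).

Definition nerr (l l' : 'I_M) (r : {ffun 'I_N -> 'I_p}) : nat :=
  #|[set i in Dset l l' | r i != c l i]|.

Definition A_MD (l l' : 'I_M) (r : {ffun 'I_N -> 'I_p}) : bool :=
  ((#|Dset l l'| - 1) %/ 2 < nerr l l' r)%N.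

Definition weight (l : 'I_M) (i : 'I_N) : R := ln (/ eps l i).

Definition dwmin (l l' : 'I_M) : R := \big[Rplus/0%R]_(i in Dset l l') weight l i.

Definition A_wMD (l l' : 'I_M) (r : {ffun 'I_N -> 'I_p}) : bool :=
  Rlt_dec (/ 2 * dwmin l l')%R
    (\big[Rplus/0%R]_(i in Dset l l') (weight l i * (if r i != c l i then 1 else 0))%R).

Definition trivial_pair (l l' : 'I_M) : bool :=
  [exists l'' : 'I_M, (l'' != l) && (Dset l l'' \proper Dset l l')].

Definition Pe_MD : R :=
  (/ INR M * \big[Rplus/0%R]_(l : 'I_M)
     \big[Rplus/0%R]_(l' | (l' != l) && ~~ trivial_pair l l') Prob l (A_MD l l'))%R.

Definition Pe_wMD : R :=
  (/ INR M * \big[Rplus/0%R]_(l : 'I_M)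
     \big[Rplus/0%R]_(l' | (l' != l) && ~~ trivial_pair l l') Prob l (A_wMD l l'))%R.

End Code.

(* Main.v *)
(** Restrict to the [n] positions where the two codewords differ, and let [A] be
    the random set of erroneous positions.  Call [A] light if its weight exceeds
    half of the total weight, i.e. [(\prod_(t in A) e t)^2 < \prod_t e t]; wMDD
    errs when [A] is light, MDD when [n <= 2 #|A|].  At most one of [A] and its
    complement is light, so it is enough to show that, for each [k < n/2], the
    light sets of cardinality [k] are together at most as probable as their
    complements.  This may fail for a single set.

    Fix [k] disjoint pairs of positions and consider the sets [S_X] that contain
    exactly one element of each pair, [X] being the set of pairs from which the
    element with the larger error probability is taken.  The [X] with [S_X] light
    form a downset, and [P(S_X) <= P(~: S_Y)] when [S_X], [S_Y] are light and [X],
    [Y] disjoint.  Every downset [D] has a permutation [pi] with [X] and [pi X]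
    disjoint (Berge), hence the claim holds for the transversals of the [k]
    pairs.  Averaging over all choices of the pairs gives it for all [k]-sets. *)

From Stdlib Require Import Reals Lra.
From mathcomp Require Import all_boot all_order all_fingroup all_algebra.
From mathcomp Require Import boolp Rstruct zify.
Require Import Defs.
Delimit Scope R_scope with R.

Set Implicit Arguments.
Unset Strict Implicit.
Unset Printing Implicit Defensive.
Import Order.TTheory GRing.Theory Num.Theory.
Local Open Scope ring_scope.

(** * Sums over downsets of subsets *)

Lemma sum_subset_setU1 (V : nmodType) (I : finType) (a : I) (U : {set I})
    (F : {set I} -> V) : a \notin U ->
  \sum_(X : {set I} | X \subset a |: U) F X =
  \sum_(X : {set I} | X \subset U) F X + \sum_(X : {set I} | X \subset U) F (a |: X).
Proof.
move=> aU; rewrite (bigID (fun X : {set I} => a \notin X)) /=; congr (_ + _).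
  apply: eq_bigl => X; apply/andP/idP => [[XU aX]|XU].
    by rewrite -(setU1K aU) subsetD1 XU.
  by rewrite (subset_trans XU (subsetUr _ _)) (contra (subsetP XU a)).
rewrite (reindex_onto (fun X => a |: X) (fun X => X :\ a)) /=; last first.
  by move=> X /andP[_]; rewrite negbK => aX; rewrite setD1K.
apply: eq_bigl => X; rewrite negbK setU11 andbT.
apply/andP/idP => [[XU /eqP <-]|XU].
  by rewrite -(setU1K aU) setSD.
by rewrite setUS // setU1K // (contra (subsetP XU a)).
Qed.

(* Berge's permutation theorem for downsets, in the form of an inequality of sums,
   with the same induction on the ground set. *)
Lemma sum_downset_le (R : numDomainType) (I : finType) (U : {set I})
    (D : pred {set I}) (f g : {set I} -> R) :
    (forall X Y : {set I}, Y \subset X -> D X -> D Y) ->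
    (forall X Y : {set I}, X \subset U -> Y \subset U -> D X -> D Y -> [disjoint X & Y] ->
       f X <= g Y) ->
  \sum_(X : {set I} | X \subset U) (if D X then f X else 0) <=
  \sum_(X : {set I} | X \subset U) (if D X then g X else 0).
Proof.
elim: {U}#|U| {-2}U (erefl #|U|) D f g => [|n IHn] U.
  move/eqP; rewrite cards_eq0 => /eqP-> D f g downD fg.
  rewrite !(big_pred1 set0); try by move=> X; rewrite subset0.
  by case: ifP => // D0; rewrite fg ?sub0set // -setI_eq0 setI0.
move=> cardU D f g downD fg.
have /card_gt0P[a aU]: (0 < #|U|)%N by rewrite cardU.
have defU : U = a |: U :\ a by rewrite setD1K.
have aU' : a \notin U :\ a by rewrite !inE eqxx.
have {cardU} cardU' : #|U :\ a| = n.
  by apply/eqP; rewrite -eqSS -cardU (cardsD1 a U) aU.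
set U' := U :\ a in defU aU' cardU'.
have subU (X : {set I}) : X \subset U' -> X \subset U.
  by move=> XU; rewrite defU (subset_trans XU) ?subsetUr.
have subUa (X : {set I}) : X \subset U' -> a |: X \subset U by move=> XU; rewrite defU setUS.
rewrite defU !(sum_subset_setU1 _ aU').
have down1 X : D (a |: X) -> D X by apply: downD; rewrite subsetUr.
(* When both [X] and [a |: X] are in [D], their [g]-values are swapped: [f X] is paired with
   [g (a |: X)] and [f (a |: X)] with [g X]. Since [a] is then on one side only, disjointness within
   [U'] suffices. *)
rewrite [leRHS](_ : _ =
    \sum_(X : {set I} | X \subset U')
       (if D X then (if D (a |: X) then g (a |: X) else g X) else 0) +
    \sum_(X : {set I} | X \subset U') (if D (a |: X) then g X else 0)); last first.
  rewrite -!big_split; apply: eq_bigr => X _ /=.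
  have := @down1 X; case: (D (a |: X)) => [->|_] //; first by rewrite addrC.
apply: lerD.
  apply: IHn => // X Y XU YU DX DY dXY.
  case: ifP => DaY; apply: fg => //; rewrite ?subUa ?subU //.
  rewrite -setI_eq0 setIUr setU_eq0 !setI_eq0 dXY andbT disjoint_sym disjoints1.
  by apply: contra aU' => /(subsetP XU).
apply: (IHn _ _ (fun X => D (a |: X))) => // [X Y YX|X Y XU YU DX DY dXY].
  by apply: downD; rewrite setUS.
apply: fg; rewrite ?subUa ?subU //; first exact: down1.
rewrite -setI_eq0 setIUl setU_eq0 !setI_eq0 dXY andbT disjoints1.
by apply: contra aU' => /(subsetP YU).
Qed.

(** * Averaging over permutations *)

Lemma perm_imset_exists (T : finType) (A B : {set T}) :
  #|A| = #|B| -> exists s : {perm T}, s @: A = B.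
Proof.
move=> cAB.
pose l (C : {set T}) := enum C ++ enum (~: C).
have size_l C : size (l C) = #|T|.
  by rewrite size_cat -!cardE cardsC.
have uniq_l C : uniq (l C).
  rewrite cat_uniq !enum_uniq /= andbT; apply/hasPn => x.
  by rewrite !mem_enum inE.
have mem_l C x : x \in l C by rewrite mem_cat !mem_enum inE orbN.
(* List [A] before its complement, and [B] likewise; [f] matches the two lists by position. *)
pose f x := nth x (l B) (index x (l A)).
have ltf x C : (index x (l A) < size (l C))%N by rewrite size_l -(size_l A) index_mem.
have f_inj : injective f.
  move=> x y; rewrite /f (set_nth_default y) // => /eqP.
  by rewrite nth_uniq // => /eqP/(congr1 (nth x (l A))); rewrite nth_index // (set_nth_default y) ?nth_index.
exists (perm f_inj); apply/eqP; rewrite eqEcard card_imset ?cAB ?leqnn ?andbT; last exact: perm_inj.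
apply/subsetP => _ /imsetP[x xA ->]; rewrite permE /f.
have lt : (index x (l A) < size (enum B))%N.
  by rewrite index_cat mem_enum xA -cardE -cAB cardE index_mem mem_enum.
by rewrite nth_cat lt -mem_enum mem_nth.
Qed.

Lemma sum_perm_imset (R : nmodType) (T : finType) (phi : {set T} -> R) (A B : {set T}) :
  #|A| = #|B| ->
  \sum_(s : {perm T}) phi (s @: A) = \sum_(s : {perm T}) phi (s @: B).
Proof.
case/perm_imset_exists => t <-.
rewrite [RHS](reindex_inj (mulgI t^-1%g)) /=; apply: eq_bigr => s _.
rewrite -imset_comp; congr (phi _); apply: eq_imset => x /=.
by rewrite permM permK.
Qed.

(** Averaged over all permutations, every [k]-set contributes the same amount [S]. The sum over the
    family, nonempty thanks to [i0], and the sum over all [k]-sets thus both have the sign of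
    [S]. *)
Lemma sum_card_le0 (R : numFieldType) (T : finType) (phi : {set T} -> R) (k : nat)
    (I : finType) (P : pred I) (F : I -> {set T}) (i0 : I) :
    P i0 -> (forall i, P i -> #|F i| = k) ->
    (forall s : {perm T}, \sum_(i | P i) phi (s @: F i) <= 0) ->
  \sum_(A : {set T} | #|A| == k) phi A <= 0.
Proof.
move=> Pi0 cF le0.
pose S := \sum_(s : {perm T}) phi (s @: F i0).
have S_le0 : S <= 0.
  have: \sum_(s : {perm T}) \sum_(i | P i) phi (s @: F i) <= 0 by apply: sumr_le0.
  rewrite exchange_big /= (eq_bigr (fun=> S)) => [|i Pi].
    rewrite sumr_const pmulrn_lle0 //; apply/card_gt0P; exists i0; exact: Pi0.
  by apply: sum_perm_imset; rewrite !cF.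
have defS : \sum_(A : {set T} | #|A| == k) phi A *+ #|{perm T}| =
    S *+ #|[pred A : {set T} | #|A| == k]|.
  rewrite -(sumr_const _ S) /=.
  transitivity (\sum_(A : {set T} | #|A| == k) \sum_(s : {perm T}) phi (s @: A)).
    rewrite exchange_big /= sumrMnl -sumr_const.
    apply: eq_bigr => s _ /=.
    rewrite [RHS](reindex_inj (imset_inj (@perm_inj _ s^-1%g))).
    apply: eq_big => [A|A _].
      by rewrite card_imset //; exact: perm_inj.
    congr (phi _); rewrite -imset_comp -[LHS]imset_id; apply: eq_imset => x /=.
    by rewrite permKV.
  by apply: eq_bigr => A /eqP cA; apply: sum_perm_imset; rewrite cA cF.
have: \sum_(A : {set T} | #|A| == k) phi A *+ #|{perm T}| <= 0.
  by rewrite defS mulrn_wle0.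
by rewrite sumrMnl pmulrn_lle0 // -cardsT; apply/card_gt0P; exists 1%g; rewrite inE.
Qed.

(** * Light sets and transversals of disjoint pairs *)

Definition error_prob (R : pzRingType) (T : finType) (e : T -> R) (A : {set T}) : R :=
  \prod_t (if t \in A then e t else 1 - e t).

(* With [w = ln (1 / e)]: the weight of [A] exceeds half of the total weight. *)
Definition light (R : numDomainType) (T : finType) (e : T -> R) (A : {set T}) : bool :=
  (\prod_(t in A) e t) ^+ 2 < \prod_t e t.

Definition transversal_of (T I : finType) (h : I -> bool -> T) (X : {set I}) : {set T} :=
  [set h i (i \in X) | i : I].

Lemma error_probE (R : comPzRingType) (T : finType) (e : T -> R) (A : {set T}) :
  error_prob e A = \prod_(t in A) e t * \prod_(t in ~: A) (1 - e t).
Proof.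
rewrite /error_prob (bigID (mem A)) /=; congr (_ * _).
  by apply: eq_bigr => t ->.
by apply: eq_big => [t|t /negPf->] //; rewrite inE.
Qed.

Lemma prod_setC (R : comPzSemiRingType) (T : finType) (F : T -> R) (A : {set T}) :
  \prod_t F t = \prod_(t in A) F t * \prod_(t in ~: A) F t.
Proof.
rewrite (bigID (mem A)) /=; congr (_ * _).
by apply: eq_bigl => t; rewrite inE.
Qed.

Section Transversals.
Variables (R : realFieldType) (T I : finType) (e : T -> R) (h : I -> bool -> T).
Hypothesis e_gt0 : forall t, 0 < e t.
Hypothesis e_lt1 : forall t, e t < 1.
Hypothesis h_inj : forall i j b b', h i b = h j b' -> i = j /\ b = b'.

Lemma prod_transversal (F : T -> R) (X : {set I}) :
  \prod_(t in transversal_of h X) F t = \prod_i F (h i (i \in X)).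
Proof. by rewrite big_imset //= => i j _ _ /h_inj[]. Qed.

Lemma prod_e_gt0 (P : pred T) : 0 < \prod_(t | P t) e t.
Proof. by apply: prodr_gt0. Qed.

Hypothesis e_le : forall i, e (h i false) <= e (h i true).

Lemma e_mono i (b b' : bool) : (b ==> b') -> e (h i b) <= e (h i b').
Proof. by case: b b' => [] [] //= _; exact: e_le. Qed.

(** Passing to a subset of [X] replaces some chosen elements by their partners of smaller error
    probability, so the product of the [e t] can only decrease. *)
Lemma light_transversal_down (X Y : {set I}) : Y \subset X ->
  light e (transversal_of h X) -> light e (transversal_of h Y).
Proof.
move=> /subsetP YX; apply: le_lt_trans.
rewrite ler_sqr ?nnegrE; try exact/ltW/prod_e_gt0.
rewrite !prod_transversal; apply: ler_prod => i _; rewrite ltW //=.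
by apply/e_mono/implyP; apply: YX.
Qed.

(** Erroneous and correct positions are compared separately. For the former, multiplying the two
    lightness inequalities bounds the product over [A] times that over [B] by the total product;
    cancel the product over [B]. *)
Lemma error_prob_transversal_le (X Y : {set I}) :
    light e (transversal_of h X) -> light e (transversal_of h Y) ->
    [disjoint X & Y] ->
  error_prob e (transversal_of h X) <= error_prob e (~: transversal_of h Y).
Proof.
set A := transversal_of h X; set B := transversal_of h Y => lA lB dXY.
have v_ge0 t : 0 <= 1 - e t by rewrite subr_ge0 ltW.
rewrite !error_probE setCK; apply: ler_pM.
- exact/ltW/prod_e_gt0.
- exact: prodr_ge0.
- rewrite -(ler_pM2l (prod_e_gt0 (mem B))) -prod_setC.
  rewrite -ler_sqr ?nnegrE ?mulr_ge0 ?(ltW (prod_e_gt0 _)) //.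
  rewrite exprMn mulrC [leRHS]expr2; apply/ltW/ltr_pM => //; exact: sqr_ge0.
(* For the correct positions, keep only the partners of the elements of [A] and drop the other
   factors, which are at most 1. As [Y] is contained in [~: X], the rest is compared pair by
   pair. *)
have subC : transversal_of h (~: X) \subset ~: A.
  apply/subsetP => _ /imsetP[i _ ->]; rewrite !inE.
  apply/imsetP => -[j _] /h_inj[-> /eqP].
  by case: (j \in X).
apply: (@le_trans _ _ (\prod_(t in transversal_of h (~: X)) (1 - e t))).
  rewrite [leLHS](bigID (mem (transversal_of h (~: X)))) /=.
  rewrite [leRHS](_ : _ = \prod_(t in ~: A | t \in transversal_of h (~: X)) (1 - e t)).
    rewrite ler_piMr ?prodr_ge0 // prodr_ile1 // => t _.
    by rewrite v_ge0 gerBl ltW.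
  by apply: eq_bigl => t /=; rewrite andb_idl // => /(subsetP subC).
rewrite !prod_transversal; apply: ler_prod => i _; rewrite v_ge0 lerB //=.
apply/e_mono/implyP => iY; rewrite inE.
by rewrite (disjointFl dXY).
Qed.

Lemma sum_transversal_le0_sorted :
  \sum_X (if light e (transversal_of h X)
          then error_prob e (transversal_of h X) - error_prob e (~: transversal_of h X)
          else 0) <= 0.
Proof.
pose D X := light e (transversal_of h X).
have := @sum_downset_le R I setT D (error_prob e \o transversal_of h)
          (fun X => error_prob e (~: transversal_of h X)) light_transversal_down.
move=> /(_ (fun X Y _ _ DX DY => error_prob_transversal_le DX DY)).
rewrite -subr_le0 -sumrB; apply: le_trans; rewrite le_eqVlt; apply/orP; left.
apply/eqP/eq_big => [X|X _]; first by rewrite subsetT.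
by rewrite /D /=; case: ifP; rewrite ?subr0.
Qed.

End Transversals.

Lemma sum_transversal_le0 (R : realFieldType) (T I : finType) (e : T -> R)
    (h : I -> bool -> T) :
    (forall t, 0 < e t) -> (forall t, e t < 1) ->
    (forall i j b b', h i b = h j b' -> i = j /\ b = b') ->
  \sum_X (if light e (transversal_of h X)
          then error_prob e (transversal_of h X) - error_prob e (~: transversal_of h X)
          else 0) <= 0.
Proof.
move=> e_gt0 e_lt1 h_inj.
(* [z] marks the pairs labelled in the wrong order. Swapping their labels only permutes the
   transversals, through [flip]. *)
pose z i := e (h i true) < e (h i false).
pose h' i b := h i (b (+) z i).
have h'_inj i j b b' : h' i b = h' j b' -> i = j /\ b = b'.
  by case/h_inj => -> /addIb.
have h'_le i : e (h' i false) <= e (h' i true).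
  by rewrite /h' /z /=; case: ltP => [/ltW|].
apply: le_trans (sum_transversal_le0_sorted e_gt0 e_lt1 h'_inj h'_le).
pose flip (X : {set I}) := [set i | (i \in X) (+) z i].
have flipK : involutive flip.
  by move=> X; apply/setP => i; rewrite !inE addbK.
have trE X : transversal_of h' X = transversal_of h (flip X).
  by apply: eq_imset => i; rewrite inE.
rewrite (reindex_inj (inv_inj flipK)) /=.
by rewrite le_eqVlt; apply/orP; left; apply/eqP/eq_bigr => X _; rewrite trE.
Qed.

(** * From transversals to all sets *)

Lemma sum_light_card_le0 (R : realFieldType) (T : finType) (e : T -> R) (k : nat) :
    (forall t, 0 < e t) -> (forall t, e t < 1) -> (k + k <= #|T|)%N ->
  \sum_(A : {set T} | #|A| == k)
     (if light e A then error_prob e A - error_prob e (~: A) else 0) <= 0.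
Proof.
move=> e_gt0 e_lt1 lek.
(* Pairs the [i]-th element of [T] with the [(k + i)]-th. *)
pose h (i : 'I_k) (b : bool) : T :=
  enum_val (widen_ord lek (unsplit (if b then inr i else inl i))).
have h_inj i j b b' : h i b = h j b' -> i = j /\ b = b'.
  move/enum_val_inj/(congr1 val) => /= /val_inj/(can_inj unsplitK).
  by case: b b' => [] [] // -[->].
apply: (@sum_card_le0 _ _ _ _ _ predT (transversal_of h) set0) => // [X _|s].
  by rewrite card_imset ?card_ord // => i j /h_inj[].
have sh_inj i j b b' : s (h i b) = s (h j b') -> i = j /\ b = b'.
  by move/perm_inj/h_inj.
apply: le_trans (sum_transversal_le0 e_gt0 e_lt1 sh_inj).
rewrite le_eqVlt; apply/orP; left; apply/eqP/eq_bigr => X _.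
by rewrite /transversal_of -imset_comp.
Qed.

Lemma sum_light_half_le0 (R : realFieldType) (T : finType) (e : T -> R) :
    (forall t, 0 < e t) -> (forall t, e t < 1) ->
  \sum_(A : {set T} | (#|A| + #|A| < #|T|)%N)
     (if light e A then error_prob e A - error_prob e (~: A) else 0) <= 0.
Proof.
move=> e_gt0 e_lt1.
pose p (A : {set T}) : 'I_#|T|.+1 := inord #|A|.
rewrite (partition_big p (fun k : 'I_#|T|.+1 => (k + k < #|T|)%N)) /=.
  apply: sumr_le0 => k ltk.
  apply: le_trans (sum_light_card_le0 e_gt0 e_lt1 (ltnW ltk)).
  rewrite le_eqVlt; apply/orP; left; apply/eqP/eq_bigl => A.
  have -> : (p A == k) = (#|A| == k) by rewrite -val_eqE /= inordK // ltnS max_card.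
  by rewrite andb_idl // => /eqP->.
by move=> A; rewrite /p inordK // ltnS max_card.
Qed.

(** Cancelling the product over [A] shows that [A] is light exactly when its product is smaller than
    that of its complement. *)
Lemma light_setC (R : realFieldType) (T : finType) (e : T -> R) (A : {set T}) :
  (forall t, 0 < e t) -> light e A -> ~~ light e (~: A).
Proof.
move=> e_gt0; rewrite /light (prod_setC e A) -leNgt => /ltW.
have := prodr_gt0 (P := mem A) (index_enum T) (fun t _ => e_gt0 t).
have := prodr_gt0 (P := mem (~: A)) (index_enum T) (fun t _ => e_gt0 t).
rewrite /=; move: (\prod_(t in A) _) (\prod_(t in ~: A) _) => a b b_gt0 a_gt0.
by rewrite !expr2 ler_pM2l // ler_pM2r.
Qed.

Lemma sum_light_le (R : realFieldType) (T : finType) (e : T -> R) :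
    (forall t, 0 < e t) -> (forall t, e t < 1) ->
  \sum_(A : {set T} | light e A) error_prob e A <=
  \sum_(A : {set T} | (#|T| <= #|A| + #|A|)%N) error_prob e A.
Proof.
move=> e_gt0 e_lt1.
have P_ge0 A : 0 <= error_prob e A.
  by apply: prodr_ge0 => t _; case: ifP; rewrite ?subr_ge0 ltW.
pose small (A : {set T}) := (#|A| + #|A| < #|T|)%N.
have le_half : \sum_(A | small A && light e A) error_prob e A <=
               \sum_(A | small (~: A) && light e (~: A)) error_prob e A.
  rewrite [leRHS](reindex_inj (inv_inj (@setCK T))) /=.
  have := sum_light_half_le0 e_gt0 e_lt1.
  rewrite -big_mkcondr sumrB subr_le0 => /le_trans-> //.
  by rewrite le_eqVlt; apply/orP; left; apply/eqP/eq_bigl => A; rewrite setCK.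
(* Small light sets are traded for their complements. These are large and not light, so they do not
   collide with the light sets that are not small. *)
rewrite (bigID small) /=; under eq_bigl do rewrite andbC.
apply: le_trans (lerD le_half (lexx _)) _.
rewrite big_mkcond [X in _ + X]big_mkcond [leRHS]big_mkcond -big_split /=.
apply: ler_sum => A _.
have large : small (~: A) -> (#|T| <= #|A| + #|A|)%N.
  by rewrite /small -(cardsC A); lia.
have := @light_setC R T e A e_gt0; rewrite -[(_ <= _)%N]negbK -ltnNge -/(small A) in large *.
case: (light e A) => /= [/(_ isT)/negPf-> | _]; rewrite ?andbF ?add0r ?addr0 ?andbT //.
case: ifP => [/andP[/large-> _] //|_].
by case: ifP.
Qed.

(** * From received words to error sets *)

(** Positions in [D] are renumbered by [enum_val], so that the bounds for a full finite type
    apply. *)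
Definition error_set (N p : nat) (D : {set 'I_N}) (c : 'I_N -> 'I_p)
    (r : {ffun 'I_N -> 'I_p}) : {set 'I_#|D|} :=
  [set t | r (enum_val t) != c (enum_val t)].

Lemma sum_error_set (R : comPzRingType) (N p : nat) (D : {set 'I_N}) (c : 'I_N -> 'I_p)
    (q : 'I_N -> 'I_p -> R) (Q : pred {set 'I_#|D|}) :
    (forall i, \sum_a q i a = 1) ->
  \sum_(r | Q (error_set D c r)) \prod_i q i (r i) =
  \sum_(S | Q S) error_prob (fun t => \sum_(a | a != c (enum_val t)) q (enum_val t) a) S.
Proof.
move=> q1; rewrite (partition_big (error_set D c) Q) //=.
apply: eq_bigr => S QS.
(* The words with error set [S] form a product set: coordinates in [D] are forced right or wrong by
   [S], all others are free and sum to 1. *)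
pose G i := [pred a | (i \in D) ==> ((a != c i) == (i \in [set enum_val t | t in S]))].
transitivity (\sum_(r in family G) \prod_i q i (r i)).
  apply: eq_bigl => r; apply/andP/familyP => [[_ /eqP defS] i|Gr].
    rewrite inE /=; apply/implyP => iD; apply/eqP.
    rewrite -(enum_rankK_in iD iD) mem_imset; last exact: enum_val_inj.
    by rewrite -defS inE.
  have defS : error_set D c r = S.
    apply/setP => t; rewrite inE.
    have := Gr (enum_val t); rewrite inE /= => /implyP/(_ (enum_valP t))/eqP->.
    by rewrite mem_imset //; exact: enum_val_inj.
  by rewrite defS.
rewrite -(bigA_distr_big_dep (fun i => mem (G i))) /= (bigID (mem D)) /= [X in _ * X]big1 ?mulr1; last first.
  move=> i /negPf iD; rewrite -[RHS](q1 i); apply: eq_bigl => a.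
  by rewrite !inE iD.
rewrite big_enum_val; apply: eq_bigr => t _.
have Gt a : (a \in G (enum_val t)) = ((a != c (enum_val t)) == (t \in S)).
  by rewrite inE /= enum_valP /= mem_imset //; exact: enum_val_inj.
under eq_bigl do rewrite Gt.
case: (t \in S); first by apply: eq_bigl => a; rewrite eqb_id.
apply/eqP; rewrite eq_sym subr_eq -(q1 (enum_val t)).
rewrite (bigID (fun a => a != c (enum_val t))) /= addrC; apply/eqP; congr (_ + _).
by apply: eq_bigl => a; rewrite eqbF_neg.
Qed.

(** * Logarithms of products *)

Lemma lnM (x y : R) : 0 < x -> 0 < y -> ln (x * y) = ln x + ln y.
Proof. by move=> /RltP x0 /RltP y0; apply: ln_mult. Qed.

Lemma ltr_ln (x y : R) : 0 < x -> 0 < y -> (ln x < ln y) = (x < y).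
Proof.
move=> /RltP x0 /RltP y0; apply/RltP/RltP; first exact: ln_lt_inv.
exact: ln_increasing.
Qed.

Lemma ln_prod (I : finType) (P : pred I) (F : I -> R) : (forall i, 0 < F i) ->
  ln (\prod_(i | P i) F i) = \sum_(i | P i) ln (F i).
Proof.
move=> F0.
suff [] : 0 < \prod_(i | P i) F i /\ ln (\prod_(i | P i) F i) = \sum_(i | P i) ln (F i) by [].
elim/big_rec2: _ => [|i s x _ [s0 <-]]; first by split; [exact: ltr01 | exact: ln_1].
split; first exact: mulr_gt0.
by rewrite -lnM.
Qed.

(** * The pairwise error events *)

Section PairwiseError.
Variables (p N M : nat) (c : 'I_M -> 'I_N -> 'I_p) (q : 'I_M -> 'I_N -> 'I_p -> R).
Variable eps : 'I_M -> 'I_N -> R.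
Hypothesis q1 : forall l i, \sum_a q l i a = 1.
Hypothesis epsE : forall l i, eps l i = \sum_(a | a != c l i) q l i a.
Hypothesis eps_gt0 : forall l i, 0 < eps l i.
Hypothesis eps_lt1 : forall l i, eps l i < 1.
Variables l l' : 'I_M.

Let D := Dset c l l'.
Let E (r : {ffun 'I_N -> 'I_p}) := error_set D (c l) r.
Let e (t : 'I_#|D|) := eps l (enum_val t).

Lemma ProbE (A : pred {ffun 'I_N -> 'I_p}) (Q : pred {set 'I_#|D|}) :
  (forall r, A r = Q (E r)) -> Prob q l A = \sum_(S | Q S) error_prob e S.
Proof.
move=> AQ.
transitivity (\sum_(r | Q (E r)) \prod_i q l i (r i)).
  by rewrite big_mkcond; apply: eq_bigr => r _; rewrite AQ.
rewrite /E sum_error_set //; apply: eq_bigr => S _; apply: eq_bigr => t _.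
by rewrite /e epsE.
Qed.

(** For [d > 0], exceeding [(d - 1) %/ 2] means reaching [d / 2]. At [d = 0] the left side is false
    and the right side true. *)
Lemma A_MDE (r : {ffun 'I_N -> 'I_p}) : (0 < #|D|)%N ->
  A_MD c l l' r = (#|'I_#|D| | <= #|E r| + #|E r|)%N.
Proof.
move=> D_gt0.
have nerrE : nerr c l l' r = #|E r|.
  rewrite /nerr -!sum1_card (eq_bigl (fun i => (i \in D) && (r i != c l i))); last first.
    by move=> i; rewrite inE.
  by rewrite big_enum_val_cond; apply: eq_bigl => t; rewrite inE.
by rewrite /A_MD nerrE card_ord -/D; lia.
Qed.

Lemma A_wMDE (r : {ffun 'I_N -> 'I_p}) : A_wMD c eps l l' r = light e (E r).
Proof.
have e0 t : 0 < e t by exact: eps_gt0.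
have wE t : weight eps l (enum_val t) = - ln (e t) :> R.
  by rewrite /weight ln_Rinv //; apply/RltP.
have errE : \big[Rplus/0%R]_(i in D)
    (weight eps l i * (if r i != c l i then 1 else 0))%R = - ln (\prod_(t in E r) e t).
  rewrite ln_prod // -sumrN big_enum_val [RHS]big_mkcond; apply: eq_bigr => t _.
  rewrite inE wE; case: ifP => _; [exact: mulr1 | exact: mulr0].
have totE : dwmin c eps l l' = - ln (\prod_t e t).
  by rewrite /dwmin big_enum_val ln_prod // -sumrN; apply: eq_bigr => t _.
rewrite /A_wMD -/D errE totE /light.
have pE : 0 < \prod_(t in E r) e t by exact: prodr_gt0.
have pT : 0 < \prod_t e t by exact: prodr_gt0.
rewrite -ltr_ln ?exprn_gt0 // expr2 lnM //.
move: (ln _) (ln _) => x y.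
(* Here [x] is the logarithm of the product over the error set and [y] that of the total product. *)
have half_lt : (x + x < y)%R <-> (/ 2 * - y < - x)%R by split; lra.
case: Rlt_dec => [/half_lt/RltP-> //|H].
by apply/esym/negP => /RltP/half_lt.
Qed.

Lemma Prob_wMD_le_MD : (0 < #|D|)%N ->
  Prob q l (A_wMD c eps l l') <= Prob q l (A_MD c l l').
Proof.
move=> D_gt0.
pose half (S : {set 'I_#|D|}) := (#|'I_#|D| | <= #|S| + #|S|)%N.
rewrite (ProbE A_wMDE) (@ProbE (A_MD c l l') half (fun r => A_MDE r D_gt0)).
by apply: sum_light_le => t; [exact: eps_gt0 | exact: eps_lt1].
Qed.

End PairwiseError.

Theorem theorem1 (p N M : nat) (hp : (2 <= p)%N) (hN : (1 <= N)%N)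
  (hM : (0 < M)%N)
  (c : 'I_M -> 'I_N -> 'I_p) (hc : injective c)
  (q : 'I_M -> 'I_N -> 'I_p -> R)
  (hq0 : forall l i a, (0 <= q l i a)%R)
  (hq1 : forall l i, \big[Rplus/0%R]_(a : 'I_p) q l i a = 1%R)
  (eps : 'I_M -> 'I_N -> R)
  (heps : forall l i, eps l i = \big[Rplus/0%R]_(a | a != c l i) q l i a)
  (heps01 : forall l i, (0 < eps l i < 1)%R) :
  (Pe_wMD c q eps <= Pe_MD c q)%R.
Proof.
have eps_gt0 l i : 0 < eps l i by apply/RltP; case: (heps01 l i).
have eps_lt1 l i : eps l i < 1 by apply/RltP; case: (heps01 l i).
apply: Rmult_le_compat_l.
  by apply/Rlt_le/Rinv_0_lt_compat/lt_0_INR/ssrnat.ltP.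
(* Both sums run over the same nontrivial pairs, and the inequality holds for each pair. *)
apply/RleP/ler_sum => l _; apply: ler_sum => l' /andP[ll' _].
apply: Prob_wMD_le_MD => //.
(* Distinct indices carry distinct codewords, so [Dset c l l'] is nonempty. *)
rewrite card_gt0; apply: contra ll' => /eqP D0; apply/eqP/hc/funext => i.
apply/esym/eqP; rewrite -[_ == _]negbK; apply/negP => Di.
by have := in_set0 i; rewrite -D0 inE Di.
Qed.
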